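(* Let $t\ge 3$, $k\ge 3$ and $n\ge k$ be integers. Then every $n$-vertex linear $k$-uniform hypergraph that is linear Berge-$C_t$-saturated has at least $\big\lfloor\frac{n-1}{k-1}\big\rfloor$ hyperedges; that is, $$\mathrm{sat}^{lin}_k(n,\text{Berge-}C_t)\ge \bigg\lfloor\frac{n-1}{k-1}\bigg\rfloor.$$
   Context: A hypergraph $H=(V(H),E(H))$ is $k$-uniform if every hyperedge is a $k$-element subset of $V(H)$, and linear if any two distinct hyperedges share at most one vertex. A Berge cycle Berge-$C_\ell$ of length $\ell$ in $H$ is an alternating sequence $(v_1,e_1,v_2,e_2,\dots,v_\ell,e_\ell)$ of distinct vertices $v_i$ and distinct hyperedges $e_i$ of $H$ with $v_i,v_{i+1}\in e_i$ for $1\le i\le \ell-1$ and $v_\ell,v_1\in e_\ell$. A linear $k$-uniform hypergraph $H$ is linear Berge-$C_t$-saturated if $H$ contains no Berge-$C_t$, but for every $e\in\binom{V(H)}{k}\setminus E(H)$ such that $H+e$ is still linear, $H+e$ contains a Berge-$C_t$. The linear saturation number $\mathrm{sat}^{lin}_k(n,\text{Berge-}C_t)$ is the minimum number of hyperedges of an $n$-vertex linear $k$-uniform hypergraph that is linear Berge-$C_t$-saturated. *)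

(* Defs.v *)
From mathcomp Require Import all_boot.

Set Implicit Arguments.
Unset Strict Implicit.
Unset Printing Implicit Defensive.

(* A finite hypergraph with vertex set the finType V is given by its set of
   hyperedges E : {set {set V}}; isolated vertices are allowed. *)
Section Hypergraph.

Variable V : finType.
Implicit Types (E : {set {set V}}) (k t : nat).

Definition uniform k E : bool := [forall e in E, #|e| == k].

Definition linear_hypergraph E : bool :=
  [forall e in E, forall f in E, (e != f) ==> (#|e :&: f| <= 1)].

(* ordS is the cyclic successor on 'I_t, so the last index gives the condition
   that the last hyperedge contains both the last and the first vertex. *)
Definition berge_cycle E t (v : {ffun 'I_t -> V}) (e : {ffun 'I_t -> {set V}})
    : bool :=
  [&& injectiveb v, injectiveb e
    & [forall i, [&& e i \in E, v i \in e i & v (ordS i) \in e i]]].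

Definition has_berge_cycle t E : bool :=
  [exists v : {ffun 'I_t -> V}, exists e : {ffun 'I_t -> {set V}},
    berge_cycle E v e].

Definition linear_berge_saturated k t E : bool :=
  [&& uniform k E, linear_hypergraph E, ~~ has_berge_cycle t E
    & [forall e : {set V},
        [&& #|e| == k, e \notin E & linear_hypergraph (e |: E)]
          ==> has_berge_cycle t (e |: E)]].

Lemma uniform_card k E : uniform k E -> #|E| <= 'C(#|V|, k).
Proof.
move=> /forall_inP uE; rewrite -card_draws; apply: subset_leq_card.
by apply/subsetP=> e eE; rewrite inE uE.
Qed.

Lemma linear_berge_saturated_exists k t :
  0 < t -> exists E, linear_berge_saturated k t E.
Proof.
case: t => // t _.
pose P E := [&& uniform k E, linear_hypergraph E & ~~ has_berge_cycle t.+1 E].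
have P0 : P set0.
  apply/and3P; split; try by apply/forall_inP=> e; rewrite inE.
  apply/existsP=> -[v /existsP[e /and3P[_ _ /forallP/(_ ord0)]]].
  by rewrite inE.
case: (arg_maxnP (fun E : {set {set V}} => #|E|) P0) => E /and3P[uE lE bE] maxE.
exists E; rewrite /linear_berge_saturated uE lE bE /=.
apply/forallP=> e; apply/implyP=> /and3P[ek eE leE].
apply: contraT => bN.
have /maxE : P (e |: E).
  rewrite /P leE bN !andbT; apply/forall_inP=> f.
  by rewrite !inE => /predU1P[-> //|]; apply: (forall_inP uE).
by rewrite cardsU1 eE add1n /= ltnn.
Qed.

End Hypergraph.

(* The default value 'C(n, k) bounds the size of every k-uniform hypergraph on
   n vertices, so it does not affect the minimum; see sat_linP. *)
Definition sat_lin k n t : nat :=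
  \big[minn/'C(n, k)]_(E : {set {set 'I_n}} | linear_berge_saturated k t E)
    #|E|.

Lemma sat_linP k n t : 0 < t ->
  (exists2 E : {set {set 'I_n}},
     linear_berge_saturated k t E & #|E| = sat_lin k n t) /\
  (forall E : {set {set 'I_n}},
     linear_berge_saturated k t E -> sat_lin k n t <= #|E|).
Proof.
move=> t_gt0.
have [E0 satE0] := linear_berge_saturated_exists 'I_n k t_gt0.
case: (arg_minnP (fun E : {set {set 'I_n}} => #|E|) satE0) => E satE minE.
suff -> : sat_lin k n t = #|E| by split=> //; exists E.
have leC : #|E| <= 'C(n, k).
  by case/and4P: satE => /uniform_card; rewrite card_ord.
apply/eqP; rewrite eqn_leq; apply/andP; split.
  rewrite /sat_lin -big_filter.
  have : E \in [seq F <- index_enum {set {set 'I_n}}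
                 | linear_berge_saturated k t F].
    by rewrite mem_filter satE mem_index_enum.
  elim: [seq _ <- _ | _] => // F s IHs; rewrite big_cons inE geq_min.
  by case/predU1P=> [->|/IHs->]; rewrite ?leqnn ?orbT.
rewrite /sat_lin; elim/big_ind: _ => // x y xE yE.
by rewrite leq_min xE.
Qed.

(* Main.v *)
Require Import Defs.
From mathcomp Require Import all_boot.

Set Implicit Arguments.
Unset Strict Implicit.

(** If [H] had [k] or more connected components, then an edge with one vertex in
    each of [k] components would keep [H] linear and would lie on no Berge cycle,
    against saturation. So there are at most [k - 1] components, while each edge
    lowers the number of components by at most [k - 1], starting from [n]
    components; hence [n <= (k - 1) + (k - 1) |E|]. *)

(* Components are represented by a labelling [f] that is constant on edges, the
   labels playing the role of the components. *)
Definition constant_on_edges {V T : finType} (E : {set {set V}}) (f : V -> T) :=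
  forall e x y, e \in E -> x \in e -> y \in e -> f x = f y.

(** Induction on the number of edges, starting from the identity labelling: putting [e] back merges
    the at most [k] labels that occur on [e] into one, so at most [k - 1] labels are lost. *)
Lemma ex_labelling_constant_on_edges (V : finType) (k : nat)
    (E : {set {set V}}) : 0 < k -> uniform k E ->
  exists2 f : V -> V, constant_on_edges E f
    & #|V| <= #|f @: setT| + (k - 1) * #|E|.
Proof.
move=> k_gt0; have [m] := ubnP #|E|; elim: m E => // m IH E ltEm uE.
have [->|[e eE]] := set_0Vmem E.
  exists id => [e x y|]; first by rewrite inE.
  by rewrite imset_id cardsT leq_addr.
have ek : #|e| = k by apply/eqP/(forall_inP uE).
have cE : #|E| = #|E :\ e|.+1 by rewrite (cardsD1 e) eE.
have uE' : uniform k (E :\ e).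
  by apply/forall_inP=> d /setD1P[_]; apply: (forall_inP uE).
have [|f fE lef] := IH (E :\ e) _ uE'; first by rewrite -ltnS -cE.
have [x0 x0e] : exists x, x \in e by apply/card_gt0P; rewrite ek.
pose g v := if f v \in f @: e then f x0 else f v.
exists g => [d x y dE xd yd|].
  have [de|de] := eqVneq d e.
    by rewrite /g !imset_f // -de.
  by rewrite /g (fE d x y) // !inE de.
(* Labels that do not occur on [e] survive unchanged, along with the merged label [f x0]. *)
have sub : f x0 |: (f @: setT :\: f @: e) \subset g @: setT.
  apply/subsetP=> z /setU1P[->|/setDP[/imsetP[x _ ->] fx]].
    by apply/imsetP; exists x0; rewrite // /g imset_f.
  by apply/imsetP; exists x; rewrite // /g (negbTE fx).
have := subset_leq_card sub.
rewrite cardsU1 in_setD imset_f //= cE mulnS => leg.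
have := cardsID (f @: e) (f @: setT).
have := subset_leq_card (subsetIr (f @: setT) (f @: e)).
have := leq_imset_card f e; rewrite ek => le1 le2 eqc.
apply: leq_trans lef _; rewrite addnA leq_add2r -eqc.
apply: leq_trans (leq_add (leq_trans le2 le1) (leqnn _)) _.
by rewrite -[X in X + _](subnK k_gt0) -addnA addnC leq_add2r.
Qed.

(** The set [A], a choice of one vertex from each of [k] label classes, will serve as the new edge
    that contradicts saturation. *)
Lemma ex_inj_subset (V T : finType) (f : V -> T) (k : nat) :
  k <= #|f @: setT| ->
  exists2 A : {set V}, #|A| = k & {in A &, injective f}.
Proof.
case/card_geqP=> s [us sk sf].
(* Choose a preimage under [f] of each of the [k] distinct labels in [s]. *)
have /subset_mapP[r _ sE] : {subset s <= map f (enum V)}.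
  by move=> y /sf /imsetP[x _ ->]; rewrite map_f ?mem_enum.
have ur : uniq r by apply: (@map_uniq _ _ f); rewrite -sE.
have cA : #|[set x in r]| = k by rewrite cardsE (card_uniqP ur) -sk sE size_map.
exists [set x in r] => //; apply/imset_injP.
rewrite cA -sk -(card_uniqP us); apply/eqP/eq_card=> y.
rewrite sE; apply/imsetP/mapP=> -[x xr ->]; exists x => //; move: xr.
  by rewrite inE.
by rewrite inE.
Qed.

Lemma val_iter_ordS t (i : 'I_t) m : iter m (@ordS t) i = (i + m) %% t :> nat.
Proof.
elim: m => [|m IHm] /=; first by rewrite addn0 modn_small.
by rewrite IHm -addn1 modnDml addn1 addnS.
Qed.

Lemma ordS_neq t (i : 'I_t) : 1 < t -> ordS i != i.
Proof.
move=> t_gt1; apply/eqP=> /(congr1 val) /=.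
case: (ltngtP i.+1 t) (ltn_ord i) => // [lt _|eqt _].
  by rewrite modn_small // => /eqP; rewrite eqn_leq ltnn.
by rewrite eqt modnn => i0; move: t_gt1; rewrite -eqt -i0.
Qed.

(** The walk from [ordS i] around to [i] uses every cyclic step except the one leaving [i], so [g]
    keeps its value along it. *)
Lemma cyclic_eq_off_one (T : Type) t (i : 'I_t) (g : 'I_t -> T) :
  (forall j, j != i -> g (ordS j) = g j) -> g (ordS i) = g i.
Proof.
move=> gS.
have step m : m < t -> g (iter m.+1 (@ordS t) i) = g (ordS i).
  elim: m => // m IHm m_lt; rewrite iterS gS ?IHm ?(ltnW m_lt) //.
  apply/eqP=> /(congr1 (@nat_of_ord t)); rewrite val_iter_ordS => /eqP.
  rewrite -[X in _ == X](modn_small (ltn_ord i)).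
  by rewrite -{2}[nat_of_ord i]addn0 eqn_modDl mod0n modn_small.
have t_gt0 : 0 < t by apply: leq_ltn_trans (ltn_ord i).
(* After [t] steps from [i] the walk is back at [i]. *)
rewrite -(step t.-1) ?prednK //; congr g; apply: ord_inj.
by rewrite val_iter_ordS modnDr modn_small.
Qed.

Section NewEdge.

Variables (V T : finType) (E : {set {set V}}) (e : {set V}) (f : V -> T).
Hypotheses (fE : constant_on_edges E f) (fe : {in e &, injective f}).

(** Two common vertices would share a label, both lying in [d], yet [f] separates the vertices of
    [e]. *)
Lemma card_edgeI_inj_le1 d : d \in E -> #|d :&: e| <= 1.
Proof.
move=> dE; apply/card_le1_eqP=> x y /setIP[xd xe] /setIP[yd ye].
by apply: fe; rewrite // (fE (e := d) (y := x)).
Qed.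

Lemma inj_notin_edges : 1 < #|e| -> e \notin E.
Proof.
move=> e_gt1; apply/negP=> /card_edgeI_inj_le1.
by rewrite setIid leqNgt e_gt1.
Qed.

Lemma linear_hypergraphU1_inj :
  linear_hypergraph E -> linear_hypergraph (e |: E).
Proof.
move=> lE; apply/forall_inP=> a aE; apply/forall_inP=> b bE.
apply/implyP=> neq_ab; move: aE bE neq_ab.
case/setU1P=> [->|aE] /setU1P[->|bE]; rewrite ?eqxx // => neq_ab.
- by rewrite setIC card_edgeI_inj_le1.
- by rewrite card_edgeI_inj_le1.
- by move/forall_inP: lE => /(_ a aE)/forall_inP/(_ b bE)/implyP; apply.
Qed.

Lemma has_berge_cycleU1_inj t : 1 < t ->
  has_berge_cycle t (e |: E) -> has_berge_cycle t E.
Proof.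
move=> t_gt1 /existsP[v /existsP[c /and3P[/injectiveP iv /injectiveP ic]]].
move/forallP=> vc.
have [i ci|noe] := pickP (fun i => c i == e).
  (* Going around the cycle avoiding [e], the two consecutive vertices on [e]
     receive the same label, although [f] separates the vertices of [e]. *)
  have /and3P[_ vi vSi] := vc i; rewrite (eqP ci) in vi vSi.
  have /fe : f (v (ordS i)) = f (v i).
    apply: (@cyclic_eq_off_one _ _ i (fun j => f (v j))) => j ji.
    have /and3P[/setU1P[cj|cjE] vj vSj] := vc j.
      by case/eqP: ji; apply: ic; rewrite cj (eqP ci).
    exact: fE cjE vSj vj.
  by move=> /(_ vSi vi)/iv/eqP; rewrite (negbTE (ordS_neq _ t_gt1)).
apply/existsP; exists v; apply/existsP; exists c.
apply/and3P; split; try exact/injectiveP.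
by apply/forallP=> j; have := vc j; rewrite in_setU1 [c j == e]noe.
Qed.

End NewEdge.

Lemma linear_berge_saturated_labels (V T : finType) (E : {set {set V}})
    (f : V -> T) (k t : nat) :
  1 < k -> 1 < t -> linear_berge_saturated k t E -> constant_on_edges E f ->
  #|f @: setT| < k.
Proof.
move=> k_gt1 t_gt1 /and4P[_ lE bE /forallP sE] fE.
rewrite ltnNge; apply/negP=> /ex_inj_subset[e ek fe].
case/negP: bE; apply: (has_berge_cycleU1_inj fE fe) => //.
move/implyP: (sE e); apply; rewrite ek eqxx (inj_notin_edges fE fe) ?ek //=.
exact: linear_hypergraphU1_inj fE fe lE.
Qed.

Lemma linear_berge_saturated_card_ge (V : finType) (E : {set {set V}})
    (k t : nat) :
  1 < k -> 1 < t -> linear_berge_saturated k t E ->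
  (#|V| - 1) %/ (k - 1) <= #|E|.
Proof.
move=> k_gt1 t_gt1 sE; have /and4P[uE _ _ _] := sE.
have [f fE leV] := ex_labelling_constant_on_edges (ltnW k_gt1) uE.
have ltk := linear_berge_saturated_labels k_gt1 t_gt1 sE fE.
case: k k_gt1 {uE sE} leV ltk => // k; rewrite subn1 /= !ltnS => k_gt0 leV lek.
(* Here [k] stands for the former [k - 1]; the floor is at most [#|E|] once
   [#|V| - 1 < k + k * #|E|]. *)
rewrite -ltnS ltn_divLR // mulSn mulnC subn1.
(* Truncated subtraction makes the empty vertex set a separate case. *)
have [->|V_gt0] := posnP #|V|; first by rewrite addn_gt0 k_gt0.
by rewrite prednK // (leq_trans leV) // leq_add2r.
Qed.

Unset Implicit Arguments.

Theorem theorem1p2 (t k n : nat) (t_ge3 : 3 <= t) (k_ge3 : 3 <= k)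
    (n_gek : k <= n) :
  (forall (V : finType) (E : {set {set V}}),
     #|V| = n -> linear_berge_saturated k t E ->
     (n - 1) %/ (k - 1) <= #|E|) /\
  (n - 1) %/ (k - 1) <= sat_lin k n t.
Proof.
have t_gt1 := ltnW t_ge3; have k_gt1 := ltnW k_ge3.
split=> [V E <-|]; first exact: linear_berge_saturated_card_ge.
have [[E sE <-] _] := sat_linP k n (ltnW t_gt1).
by have := linear_berge_saturated_card_ge k_gt1 t_gt1 sE; rewrite card_ord.
Qed.
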